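(* For every $0\leq k\leq n-1$ denote by $v(n,k)$ the number of permutations of length $n$ avoiding the vincular pattern $1-32-4$ and having exactly $k$ right-to-left maxima to the right of $1$. Then the triangle $v(n,k)$ satisfies, for all $0\le k\le n-1$, the recurrence relation $$v(n,k)=v(n-1,k-1)+(k+1)\sum_{j=k}^{n-2}v(n-1,j),$$ where by convention $v(0,-1)=1$ and $v(n,-1)=0$ for every $n\geq 1$.
   Context: A permutation of length $n$ is a word $\pi=\pi_1\cdots\pi_n$ in which every letter of $\{1,\dots,n\}$ appears exactly once. An occurrence of the vincular pattern $1-32-4$ in $\pi$ is a choice of indices $a<b<b+1<c$ with $\pi_a<\pi_{b+1}<\pi_b<\pi_c$ (the letters playing the roles of $3$ and $2$ must be adjacent); $\pi$ avoids $1-32-4$ if there is no such occurrence. A right-to-left maximum of $\pi$ is an entry larger than all entries to its right; those ''to the right of $1$'' are the ones located strictly to the right of the entry $1$. An empty sum is $0$. *)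

(* Defs.v *)
From mathcomp Require Import all_boot all_order all_algebra all_fingroup.
Set Implicit Arguments.
Unset Strict Implicit.
Unset Printing Implicit Defensive.

Local Open Scope nat_scope.

(* A permutation of length n is s : 'S_n, read as the word s 0, ..., s (n-1);
   positions and letters are numbered from 0, so the letter 1 of the usual
   convention is the value 0 here. *)

Definition occurs_1_32_4 (n : nat) (s : 'S_n) (a b b' c : 'I_n) : bool :=
  [&& a < b, b' == b.+1 :> nat, b' < c &
      [&& s a < s b', s b' < s b & s b < s c]].

Definition avoids_1_32_4 (n : nat) (s : 'S_n) : bool :=
  ~~ [exists a, exists b, exists b', exists c, occurs_1_32_4 s a b b' c].

Definition rl_max (n : nat) (s : 'S_n) (i : 'I_n) : bool :=
  [forall j : 'I_n, (i < j) ==> (s j < s i)].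

Definition right_of_1 (n : nat) (s : 'S_n) (i : 'I_n) : bool :=
  [exists p : 'I_n, (s p == 0 :> nat) && (p < i)].

Definition nb_rl_max_right_of_1 (n : nat) (s : 'S_n) : nat :=
  #|[set i : 'I_n | rl_max s i && right_of_1 s i]|.

(* The second index is an integer because the recurrence refers to k = -1,
   where v(0,-1) = 1 and v(n,-1) = 0 for n >= 1 by convention. Indices below
   -1 are junk, with value 0. *)
Definition v (n : nat) (k : int) : nat :=
  match k with
  | Posz m =>
      #|[set s : 'S_n | avoids_1_32_4 s && (nb_rl_max_right_of_1 s == m)]|
  | Negz 0 => if n is 0 then 1 else 0
  | Negz _.+1 => 0
  end.

(* Main.v *)
Require Import Defs.
From mathcomp Require Import all_boot all_order all_algebra all_fingroup.
From mathcomp Require Import zify.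
Set Implicit Arguments.
Unset Strict Implicit.
Unset Printing Implicit Defensive.

(* Read the permutation from left to right. The number of ways to complete a
   prefix depends only on the numbers p, q, r of remaining letters that lie
   below the running minimum, between it and the last letter read, and above
   the last letter read. Call cnt p q r the number of completions with k
   right-to-left maxima to the right of 1. If the letter 1 has just been read
   (p = q = 0), the rest is a sequence of increasing runs with decreasing
   maxima, that is a set partition, so cnt 0 0 r is the Stirling number
   S(r, k); when it is the only letter left below the minimum, cnt 1 0 r is
   S(r, k) + (k+1) sum_(j > k) S(r, j). Removing the letter 1 then turns
   cnt (p+1) q r into the claimed combination of values of cnt p q r for every
   p >= 1, by induction on the number of remaining letters, and v(n, .) is
   cnt n 0 0. *)

Local Open Scope nat_scope.

(** * Stirling numbers and the binomial transform *)

Fixpoint stirling2 (n k : nat) : nat :=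
  match n, k with
  | 0, 0 => 1
  | n'.+1, k'.+1 => stirling2 n' k' + k'.+1 * stirling2 n' k'.+1
  | _, _ => 0
  end.

Lemma stirling2_small n k : n < k -> stirling2 n k = 0.
Proof.
elim: n k => [|n IHn] [|k] //= ltnk.
by rewrite !IHn ?muln0 // ltnW.
Qed.

(* The binomial transform: [bintr phi q r] is the sum of [C(r, j) phi (q + j)]
   over [j <= r]. *)
Fixpoint bintr (phi : nat -> nat) (q r : nat) : nat :=
  if r is r'.+1 then bintr phi q r' + bintr phi q.+1 r' else phi q.

Lemma eq_bintr phi psi q r : phi =1 psi -> bintr phi q r = bintr psi q r.
Proof. by move=> eq_pp; elim: r q => //= r IHr q; rewrite !IHr. Qed.

Lemma bintrD phi psi q r :
  bintr (fun x => phi x + psi x) q r = bintr phi q r + bintr psi q r.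
Proof. by elim: r q => //= r IHr q; rewrite !IHr addnACA. Qed.

Lemma bintrM c phi q r : bintr (fun x => c * phi x) q r = c * bintr phi q r.
Proof. by elim: r q => //= r IHr q; rewrite !IHr mulnDr. Qed.

Lemma bintr_sum (I : Type) (s : seq I) (phi : I -> nat -> nat) q r :
  bintr (fun x => \sum_(j <- s) phi j x) q r = \sum_(j <- s) bintr (phi j) q r.
Proof. by elim: r q => //= r IHr q; rewrite !IHr -big_split. Qed.

Lemma bintr_shift phi q r : bintr (fun x => phi x.+1) q r = bintr phi q.+1 r.
Proof. by elim: r q => //= r IHr q; rewrite !IHr. Qed.

(** Pascal's rule, unrolled along its second summand. The parameters [q + i] and [r - i.+1] are
    those of the second sum in [cnt]. *)
Lemma bintr_hockey_stick phi q r :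
  bintr phi q r = phi (q + r) + \sum_(i < r) bintr phi (q + i) (r - i.+1).
Proof.
elim: r q => [|r IHr] q; first by rewrite big_ord0 !addn0.
rewrite big_ord_recl /= addn0 subn1 [bintr phi q.+1 r]IHr addSnnS addnCA.
by congr (_ + (_ + _)); apply: eq_bigr => i _; rewrite addSnnS subSS.
Qed.

Lemma stirling2SS n k :
  stirling2 n.+1 k.+1 = stirling2 n k + k.+1 * stirling2 n k.+1.
Proof. by []. Qed.

Lemma bintrS phi q r : bintr phi q r.+1 = bintr phi q r + bintr phi q.+1 r.
Proof. by []. Qed.

(** Classically, one sums over the number of elements outside the block of a fixed element. *)
Lemma bintr_stirling2 k r : bintr (stirling2^~ k) 0 r = stirling2 r.+1 k.+1.
Proof.
elim: r k => [|r IHr] k; first by rewrite /= muln0 addn0.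
rewrite bintrS -bintr_shift IHr [in RHS]stirling2SS.
case: k => [|k].
  suff -> : bintr (fun q => stirling2 q.+1 0) 0 r = 0 by rewrite /=; lia.
  by elim: (r) {2}0 => //= m IHm q; rewrite !IHm.
under eq_bintr do rewrite stirling2SS.
by rewrite bintrD bintrM !IHr; lia.
Qed.

(* [M] only cuts off the sum over all [j > k]. *)
Definition stirling2_tail M k r :=
  stirling2 r k + k.+1 * \sum_(k.+1 <= j < M) stirling2 r j.

Lemma bintr_stirling2_tail M k r : r.+1 < M ->
  bintr (fun q => stirling2 q.+1 k + stirling2_tail M k q) 0 r =
  stirling2_tail M k r.+1.
Proof.
move=> ltrM; rewrite !bintrD bintrM bintr_sum bintr_stirling2.
rewrite (bintr_shift (stirling2^~ k)).
have := bintrS (stirling2^~ k) 0 r; rewrite !bintr_stirling2 stirling2SS => eqk.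
under eq_bigr do rewrite bintr_stirling2.
(* The reindexing brings in [stirling2 r.+1 M], which is zero because [r.+1 < M]. *)
have eq_tail : \sum_(k.+1 <= j < M) stirling2 r.+1 j =
    stirling2 r.+1 k.+1 + \sum_(k.+1 <= j < M) stirling2 r.+1 j.+1.
  rewrite -[in RHS](big_add1 _ _ k.+1 M.+1 xpredT).
  have [ltkM|leMk] := ltnP k.+1 M.
    by rewrite big_ltn // big_nat_recr // (stirling2_small ltrM) /= addn0.
  by rewrite !big_geq ?stirling2_small //; lia.
by rewrite /stirling2_tail eq_tail; lia.
Qed.

(** * Counting completions of a prefix; closed forms for [p <= 1] *)

Definition shift (b : bool) (F : nat -> nat) (k : nat) : nat :=
  if b then (if k is k'.+1 then F k' else 0) else F k.

(* [N] stands for [p + q + r]. The letter 1 has been read exactly when [p = 0],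
   and the next letter is a right-to-left maximum exactly when no remaining
   letter exceeds it. If [r = 0] the last letter read can no longer play the
   role of 3, so the letters between the minimum and it become unrestricted. *)
Fixpoint cnt (N p q r k : nat) : nat :=
  if N is N'.+1 then
    let q' := if r == 0 then 0 else q in
    let r' := if r == 0 then q else r in
    \sum_(i < p) cnt N' i 0 (N' - i) k +
    \sum_(i < r') shift ((p == 0) && (r' == i.+1))
                        (cnt N' p (q' + i) (r' - i.+1)) k
  else k == 0.

Lemma cntS N p q r k : (r = 0 -> q = 0) -> cnt N.+1 p q r k =
  \sum_(i < p) cnt N i 0 (N - i) k +
  \sum_(i < r) shift ((p == 0) && (r == i.+1))
                     (cnt N p (q + i) (r - i.+1)) k.
Proof. by case: r => [/(_ erefl) ->|]. Qed.

Arguments cnt : simpl never.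

Lemma cnt_r0 N p q k : cnt N p q 0 k = cnt N p 0 q k.
Proof. by case: N q => [|N] [|q]. Qed.

(** The recurrence of [cnt] becomes the hockey-stick expansion. Its isolated term is the choice of
    the largest remaining letter, the only choice that counts as a maximum. *)
Lemma cnt_p0 N q r k : N = q + r -> cnt N 0 q r k =
  if r is r'.+1 then shift true (fun k => bintr (stirling2^~ k) q r') k
  else stirling2 q k.
Proof.
elim: N q r k => [|N IHN] q r k eqN.
  have [-> ->] : q = 0 /\ r = 0 by lia.
  by case: k.
have cnt_pos q' r' : N = q' + r' -> cnt N.+1 0 q' r'.+1 k =
    shift true (fun k => bintr (stirling2^~ k) q' r') k.
  move=> eqN'; rewrite cntS // big_ord0 add0n big_ord_recr /= eqxx subnn.
  case: k => [|k] /=.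
    rewrite addn0 big1 // => i _.
    have ltir := ltn_ord i; rewrite /shift ifF; last by lia.
    by rewrite IHN ?subSn //; lia.
  rewrite IHN ?addn0 // bintr_hockey_stick addnC; congr (_ + _).
  apply: eq_bigr => i _.
  have ltir := ltn_ord i; rewrite /shift ifF; last by lia.
  by rewrite IHN subSn //; lia.
case: r eqN => [|r] eqN; last by apply: cnt_pos; lia.
rewrite cnt_r0; case: q eqN => // q eqN; rewrite cnt_pos; last by lia.
by case: k {cnt_pos} => //= k; rewrite bintr_stirling2.
Qed.

Lemma cnt_only_above N k : cnt N 0 0 N k = stirling2 N k.
Proof.
by rewrite cnt_p0 //; case: N k => [|N] [|k] //; rewrite -bintr_stirling2.
Qed.

(** As in [cnt_p0], but the isolated term now collects two choices: the letter 1 and the largest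
    letter. *)
Lemma cnt_p1 M N q r k : N = (q + r).+1 -> N < M.+1 -> cnt N 1 q r k =
  if r is r'.+1
  then bintr (fun q => stirling2 q.+1 k + stirling2_tail M k q) q r'
  else stirling2_tail M k q.
Proof.
elim: N q r k => [|N IHN] // q r k [eqN] ltNM.
have cnt_pos q' r' : N = q' + r'.+1 -> cnt N.+1 1 q' r'.+1 k =
    bintr (fun q => stirling2 q.+1 k + stirling2_tail M k q) q' r'.
  move=> eqN'; rewrite cntS // big_ord1 big_ord_recr /= subn0 subnn.
  rewrite cnt_only_above IHN; try lia.
  rewrite bintr_hockey_stick addnCA addnC; congr (_ + _).
    by rewrite eqN' addnS.
  apply: eq_bigr => i _.
  have ltir := ltn_ord i.
  by rewrite /shift /= IHN ?subSn //; lia.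
case: r eqN => [|r] eqN; last by apply: cnt_pos; lia.
rewrite cnt_r0; case: q eqN => [|q] eqN.
  rewrite eqN /cnt /= big_ord1 big_ord0 /stirling2_tail big1_seq ?muln0 ?addn0.
    by case: k {cnt_pos}.
  by move=> j; rewrite mem_index_iota => /andP[]; case: j.
by rewrite cnt_pos ?bintr_stirling2_tail //; lia.
Qed.

(** * The recurrence for [cnt] *)

(* The right-hand side of the recurrence, as an operator on rows. *)
Definition grow M (F : nat -> nat) (k : nat) : nat :=
  shift true F k + k.+1 * \sum_(k <= j < M) F j.

Lemma eq_grow M F G k : F =1 G -> grow M F k = grow M G k.
Proof.
move=> eqFG; rewrite /grow; congr (_ + _ * _); last exact: eq_bigr.
by case: k => /=.
Qed.

Lemma growD M F G k : grow M (fun j => F j + G j) k = grow M F k + grow M G k.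
Proof. by rewrite /grow big_split mulnDr addnACA; case: k. Qed.

Lemma grow_sum M n (F : 'I_n -> nat -> nat) k :
  grow M (fun j => \sum_i F i j) k = \sum_i grow M (F i) k.
Proof.
rewrite /grow big_split -big_distrr /= exchange_big /=; congr (_ + _).
by case: k => [|k] //=; rewrite big1.
Qed.

Lemma cnt_1_above M N k : N < M -> cnt N.+1 1 0 N k = stirling2_tail M k N.
Proof.
move=> ltNM; rewrite (@cnt_p1 M) //.
by case: N ltNM => // N ltNM; rewrite bintr_stirling2_tail.
Qed.

Lemma stirling2_grow M N k : N < M ->
  stirling2 N.+1 k + stirling2_tail M k N = grow M (stirling2 N) k.
Proof.
move=> ltNM; rewrite /grow /stirling2_tail.
have [ltkM|leMk] := ltnP k M.
  by rewrite [in RHS]big_ltn //; case: k ltkM => [|k] ltkM /=; lia.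
rewrite !big_geq ?(stirling2_small (leq_trans ltNM leMk)) //; last by lia.
case: k leMk => [|k] leMk; first by lia.
by rewrite stirling2SS (@stirling2_small N k.+1) /=; lia.
Qed.

(** [grow M] is linear, so it passes through the recurrence of [cnt]. The choices of the two
    smallest letters on the left together match that of the smallest on the right, by
    [stirling2_grow]; the others match one by one, by induction. *)
Lemma cnt_grow M N p q r k : N = p + q + r -> 0 < p -> N < M ->
  cnt N.+1 p.+1 q r k = grow M (cnt N p q r) k.
Proof.
elim: N p q r k => [|N IHN] p q r k eqN p_gt0 ltNM; first by lia.
have first_part : \sum_(i < p.+1) cnt N.+1 i 0 (N.+1 - i) k =
    \sum_(i < p) grow M (cnt N i 0 (N - i)) k.
  case: p eqN p_gt0 => // p eqN _.
  rewrite !big_ord_recl addnA /= subn0 subn1 cnt_only_above.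
  rewrite (@cnt_1_above M) ?stirling2_grow; try lia.
  rewrite -(eq_grow _ _ (cnt_only_above N)) subn0.
  congr (_ + _); apply: eq_bigr => i _; have ltip := ltn_ord i.
  by rewrite /bump /= !add1n subSS IHN //; lia.
have IHsum q' r' : N.+1 = p + q' + r' -> (r' = 0 -> q' = 0) ->
    cnt N.+2 p.+1 q' r' k = grow M (cnt N.+1 p q' r') k.
  move=> eqN' rq0; rewrite cntS //.
  under [RHS]eq_grow do rewrite cntS //.
  rewrite growD !grow_sum first_part; congr (_ + _).
  apply: eq_bigr => i _; have ltir := ltn_ord i.
  under [RHS]eq_grow do rewrite /shift gtn_eqF //=.
  by rewrite /shift /= IHN; lia.
case: r eqN => [|r] eqN; last exact: IHsum.
rewrite cnt_r0; under [RHS]eq_grow do rewrite cnt_r0.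
by apply: IHsum; lia.
Qed.

(** * Counting in lists and sums over ranks *)

Lemma count_add (T : eqType) (a b c : pred T) (s : seq T) :
  {in s, forall x, a x = b x + c x :> nat} ->
  count a s = count b s + count c s.
Proof.
elim: s => //= x s IHs eq_abc; rewrite eq_abc ?mem_head // IHs; first by lia.
by move=> y sy; apply: eq_abc; rewrite inE sy orbT.
Qed.

Lemma count_allpairs (S T U : Type) (P : pred U) (f : S -> T -> U)
    (s : seq S) (t : S -> seq T) :
  count P [seq f x y | x <- s, y <- t x] =
  \sum_(x <- s) count (fun y => P (f x y)) (t x).
Proof.
rewrite count_flatten sumnE big_map big_map.
by apply: eq_bigr => x _; rewrite count_map.
Qed.

(** The ranks are pairwise distinct and smaller than [count P s], so by pigeonhole they take each
    such value once. *)
Lemma sum_rank (phi : nat -> nat) (P : pred nat) (s : seq nat) : uniq s ->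
  \sum_(x <- s | P x) phi (count (fun y => P y && (y < x)) s) =
  \sum_(i < count P s) phi i.
Proof.
move=> uniq_s; rewrite -big_filter -size_filter.
pose rk x := count (fun y => P y && (y < x)) s.
have rkE x : rk x = count (fun y => y < x) (filter P s).
  by rewrite count_filter; apply: eq_count => y /=; rewrite andbC.
under eq_bigr do rewrite -/(rk _).
rewrite -(big_map rk xpredT) -(big_mkord xpredT).
apply: perm_big; move: (filter_uniq P uniq_s) rkE => {uniq_s}.
move: (filter P s) rk => S rk uniq_S rkE.
have rk_lt x y : x \in S -> x < y -> rk x < rk y.
  move=> Sx ltxy; rewrite !rkE.
  rewrite [in ltnRHS](@count_add _ _ (ltn^~ x) (fun z => x <= z < y)).
    by rewrite -addn1 leq_add2l -has_count; apply/hasP; exists x => //; lia.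
  by move=> z _ /=; lia.
have uniq_rk : uniq (map rk S).
  rewrite map_inj_in_uniq // => x y Sx Sy eq_rk.
  case: (ltngtP x y) => // ltxy.
    by have := rk_lt x y Sx ltxy; rewrite eq_rk ltnn.
  by have := rk_lt y x Sy ltxy; rewrite eq_rk ltnn.
rewrite /index_iota subn0.
apply: uniq_perm => //; first exact: iota_uniq.
suff rk_iota : {subset map rk S <= iota 0 (size S)}.
  by apply: (uniq_min_size uniq_rk rk_iota _).2; rewrite size_map size_iota.
move=> _ /mapP[x Sx ->]; rewrite mem_iota /= rkE.
rewrite -(count_predC (ltn^~ x) S) -[ltnLHS]addn0 ltn_add2l -has_count.
by apply/hasP; exists x => //=; rewrite ltnn.
Qed.

(** * Completions as words *)

(* [m] is the minimum and [l] the last letter of the prefix preceding [w]; a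
   descent [l x] with [m < x] is allowed only if no later letter exceeds [l]. *)
Fixpoint avoidw (m l : nat) (w : seq nat) : bool :=
  if w is x :: w' then
    [|| x < m, l < x | all (ltn^~ l) w] && avoidw (minn m x) x w'
  else true.

(* The condition [m == 0] says that the letter 1, numbered 0, has been read. *)
Fixpoint rlmaxw (m : nat) (w : seq nat) : nat :=
  if w is x :: w' then
    ((m == 0) && all (ltn^~ x) w') + rlmaxw (minn m x) w'
  else 0.

Definition nb_words (m l k : nat) (R : seq nat) : nat :=
  count (fun w => avoidw m l w && (rlmaxw m w == k)) (permutations R).

Lemma nb_wordsS m l k R : uniq R -> 0 < size R ->
  nb_words m l k R =
  \sum_(x <- R | [|| x < m, l < x | all (ltn^~ l) R])
    shift ((m == 0) && all (ltn^~ x) (rem x R))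
          (fun k => nb_words (minn m x) x k (rem x R)) k.
Proof.
move=> uniq_R R_gt0; rewrite /nb_words (seq.permP (permutationsE R_gt0)).
rewrite count_allpairs undup_id // [RHS]big_mkcond /=.
apply: eq_big_seq => x Rx.
transitivity (count (fun w => [|| x < m, l < x | all (ltn^~ l) R] &&
   (avoidw (minn m x) x w &&
   (((m == 0) && all (ltn^~ x) (rem x R)) + rlmaxw (minn m x) w == k)))
   (permutations (rem x R))).
  apply: eq_in_count => w; rewrite mem_permutations => eq_w /=.
  by rewrite andbA !(perm_all _ eq_w) [in RHS](perm_all _ (perm_to_rem Rx)).
case: ifP => _; last by rewrite count_pred0.
rewrite /shift; case: ifP => _ //=.
case: k => [|k]; last by [].
rewrite -[RHS](count_pred0 (permutations (rem x R))).
by apply: eq_count => w; rewrite andbF.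
Qed.

(** Only relative order matters, so the next letter is encoded by its rank among those below [m] or
    above [l]. The last hypothesis makes [m == 0] equivalent to having no letter of [R] below
    [m]. *)
Lemma nb_wordsE R m l k :
  uniq R -> m \notin R -> l \notin R -> m <= l -> (m == 0) || (0 \in R) ->
  nb_words m l k R =
  cnt (size R) (count (ltn^~ m) R) (count (fun y => m < y < l) R)
      (count (ltn l) R) k.
Proof.
elim: {R}(size R) {-2}R (erefl (size R)) m l k => [|N IHN] R szR m l k.
  by rewrite (size0nil szR) /nb_words /cnt /= => *; rewrite addn0 eq_sym.
move=> uniq_R mR lR leml m0.
(* If [l] exceeds all remaining letters then it may be replaced by [m]. *)
wlog nonempty_above : l lR leml / (l == m) || has (ltn l) R.
  move=> IHl; have [has_l|nhas_l] := boolP (has (ltn l) R).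
    by apply: IHl => //; rewrite has_l orbT.
  have all_l : all (ltn^~ l) R.
    rewrite -all_predC in nhas_l; apply/allP => x Rx.
    have := allP nhas_l x Rx; have: x != l by apply: contraNneq lR => <-.
    by move=> /=; lia.
  transitivity (nb_words m m k R).
    rewrite !nb_wordsS ?szR // all_l big_mkcond [RHS]big_mkcond.
    apply: eq_big_seq => x Rx; rewrite !orbT.
    have: x != m by apply: contraNneq mR => <-.
    by case: (ltngtP x m).
  rewrite (IHl m) ?eqxx // (_ : count (ltn l) R = 0); last first.
    by apply/eqP; rewrite -leqn0 leqNgt -has_count.
  rewrite cnt_r0 (_ : count (fun y => m < y < m) R = 0); last first.
    rewrite -(count_pred0 R); apply: eq_count => y /=; lia.
  congr cnt; apply: eq_in_count => y Ry.
  by have /= -> := allP all_l y Ry; rewrite andbT.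
rewrite nb_wordsS ?szR // cntS; last first.
  move/eqP; rewrite -leqn0 leqNgt -has_count => /negbTE above0.
  move: nonempty_above; rewrite above0 orbF => /eqP ->.
  by rewrite -(count_pred0 R); apply: eq_count => y /=; lia.
have cnt0E : (m == 0) = (count (ltn^~ m) R == 0).
  case: eqVneq m0 => [-> _|m_neq0 /= R0]; apply/esym.
    by rewrite -leqn0 leqNgt -has_count; apply/hasPn.
  apply/negbTE; rewrite -lt0n -has_count; apply/hasP.
  by exists 0; rewrite //= lt0n.
have remE x : x \in R -> [/\ size (rem x R) = N, uniq (rem x R),
    x \notin rem x R, {subset rem x R <= R} &
    forall a : pred nat, count a R = a x + count a (rem x R)].
  move=> Rx; split; first by rewrite size_rem // szR.
  - exact: rem_uniq.
  - by rewrite mem_rem_uniqF.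
  - exact: mem_rem.
  - by move=> a; rewrite (seq.permP (perm_to_rem Rx)).
rewrite (bigID (ltn^~ m)) /=; congr (_ + _).
  rewrite -(sum_rank (fun i => cnt N i 0 (N - i) k) (ltn^~ m)) //.
  rewrite big_seq_cond [RHS]big_seq_cond.
  apply: eq_big => [x|x /and3P[Rx _ ltxm]].
    by rewrite /=; case: (x < m); rewrite ?andbF.
  have [szR' uniq_R' R'x R'R cR] := remE x Rx.
  rewrite /shift gtn_eqF ?(leq_ltn_trans _ ltxm) //= (minn_idPr (ltnW ltxm)).
  have R'0 : (x == 0) || (0 \in rem x R).
    rewrite mem_rem_uniq // inE.
    case/orP: m0 => [/eqP m0|->]; first by move: ltxm; rewrite m0.
    by rewrite andbT eq_sym orbN.
  rewrite IHN // szR'.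
  rewrite (_ : count (fun y => x < y < x) _ = 0); last first.
    by rewrite -(count_pred0 (rem x R)); apply: eq_count => y /=; lia.
  rewrite cR ltxm ltnn /= add0n.
  rewrite (_ : count (fun y => (y < m) && (y < x)) (rem x R) =
               count (ltn^~ x) (rem x R)); last first.
    by apply: eq_count => y /=; lia.
  congr cnt; rewrite -szR' -(count_predC (ltn^~ x) (rem x R)) addKn.
  apply: eq_in_count => y R'y /=; have := memPn R'x y R'y; lia.
rewrite -(sum_rank (fun i =>
  shift ((count (ltn^~ m) R == 0) && (count (ltn l) R == i.+1))
        (cnt N (count (ltn^~ m) R) (count (fun y => m < y < l) R + i)
             (count (ltn l) R - i.+1)) k) (ltn l)) //.
rewrite big_seq_cond [RHS]big_seq_cond.
(* An admissible letter not below [m] lies above [l]: either [l = m], or some remaining letter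
   exceeds [l] and forbids a descent to a letter between [m] and [l]. *)
apply: eq_big => [x|x /and3P[Rx okx]].
  have [Rx|//] := boolP (x \in R); rewrite /=.
  have := memPn mR x Rx.
  case/orP: nonempty_above => [/eqP-> |has_l]; first by lia.
  have -> : all (ltn^~ l) R = false.
    case/hasP: has_l => y Ry ltly; apply/negbTE/allPn.
    by exists y => //; rewrite -leqNgt ltnW.
  by rewrite orbF; lia.
rewrite -leqNgt => lemx.
have [szR' uniq_R' R'x R'R cR] := remE x Rx.
have R'0 : (m == 0) || (0 \in rem x R).
  case/orP: m0 => [-> //|R0]; rewrite mem_rem_uniq // inE R0 andbT.
  by have := memPn mR x Rx; lia.
have ltlx : l < x.
  have := memPn lR x Rx; have := memPn mR x Rx.
  case/or3P: okx => [||/allP all_l]; try lia.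
  case/orP: nonempty_above => [/eqP->|/hasP[y Ry ltly]]; first by lia.
  by move: ltly (all_l y Ry) => /=; lia.
have mR' : m \notin rem x R by apply: contraNN mR; apply: R'R.
rewrite (minn_idPl lemx).
pose i := count (fun y => (l < y) && (y < x)) R; rewrite -/i.
have eq_i : count (ltn l) R = i.+1 + count (ltn x) (rem x R).
  rewrite /i !cR /= ltlx ltnn /= add0n addSn; congr _.+1.
  by apply: count_add => y R'y /=; have := memPn R'x y R'y; lia.
have eq_p : count (ltn^~ m) R = count (ltn^~ m) (rem x R).
  by rewrite cR /= ltnNge lemx.
have eq_q : count (fun y => m < y < x) (rem x R) =
    count (fun y => m < y < l) R + i.
  rewrite /i !cR /= ltnn andbF !add0n (ltnNge x l) (ltnW ltlx) andbF add0n.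
  by apply: count_add => y R'y /=; have := memPn lR y (R'R y R'y); lia.
(* The letter [x] exceeds all the other remaining letters exactly when its rank [i] is the last
   one. *)
rewrite cnt0E (_ : all _ _ = (count (ltn l) R == i.+1)); last first.
  rewrite eq_i -{2}[i.+1]addn0 eqn_add2l -leqn0 leqNgt -has_count -all_predC.
  by apply: eq_in_all => y R'y /=; have := memPn R'x y R'y; lia.
rewrite eq_i addKn eq_p -eq_q /shift; case: ifP => _.
  by case: k => // k; rewrite IHN ?szR'.
by rewrite IHN ?szR'.
Qed.

(** * Permutations as words *)

Definition word (n : nat) (s : 'S_n) : seq nat :=
  [seq val (s i) | i <- enum 'I_n].

Lemma size_word n (s : 'S_n) : size (word s) = n.
Proof. by rewrite size_map size_enum_ord. Qed.

Lemma nth_word n (s : 'S_n) (i : 'I_n) : nth 0 (word s) i = s i.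
Proof. by rewrite (nth_map i) ?size_enum_ord // nth_ord_enum. Qed.

Lemma word_perm n (s : 'S_n) : perm_eq (word s) (iota 0 n).
Proof.
rewrite -val_enum_ord /word (map_comp val s); apply: perm_map.
apply: uniq_perm; rewrite ?(map_inj_uniq perm_inj) ?enum_uniq // => i.
rewrite mem_enum; apply/mapP; exists ((s^-1)%g i); rewrite ?mem_enum //.
by rewrite permKV.
Qed.

Lemma word_inj n : injective (@word n).
Proof.
move=> s t eq_st; apply/permP => i; apply: val_inj.
by rewrite /= -!nth_word eq_st.
Qed.

(** [word] is injective and both sides have [n]! elements, so the words of permutations exhaust the
    list. *)
Lemma card_perm_count n (P : pred (seq nat)) :
  #|[set s : 'S_n | P (word s)]| = count P (permutations (iota 0 n)).
Proof.
rewrite cardsE -sum1_card sum1_count -(count_map (@word n) P).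
apply/seq.permP.
have words_uniq : uniq [seq word s | s <- index_enum 'S_n].
  by rewrite (map_inj_uniq (@word_inj n)) index_enum_uniq.
have words_sub : {subset [seq word s | s <- index_enum 'S_n] <=
                         permutations (iota 0 n)}.
  by move=> _ /mapP[s _ ->]; rewrite mem_permutations word_perm.
apply: uniq_perm; rewrite ?permutations_uniq //.
apply: (uniq_min_size words_uniq words_sub _).2.
rewrite size_permutations ?iota_uniq // size_iota size_map.
by rewrite -card_Sn -sum1_card sum1_count count_size.
Qed.

(** The first test of [avoidw] settles [b = 0], where [l] plays 3; the recursive call settles larger
    [b], with [x] joining the letters that may play 1. *)
Lemma avoidwP (m l : nat) (w : seq nat) (u := l :: w) :
  m <= l -> m \notin w -> uniq u ->
  avoidw m l w <->
  (forall b c, b.+1 < c < size u ->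
     m < nth 0 u b.+1 \/ (exists2 a, a < b & nth 0 u a < nth 0 u b.+1) ->
     nth 0 u b.+1 < nth 0 u b -> ~ nth 0 u b < nth 0 u c).
Proof.
rewrite {}/u; elim: w m l => [|x w IHw] m l leml mw uniq_u.
  by split=> // _ b c /=; lia.
move: mw uniq_u; rewrite inE negb_or => /andP[m_neq_x mw].
move=> /[dup] uniq_u /andP[lw uniq_xw].
have min_w : minn m x \notin w.
  by rewrite /minn; case: ifP => // _; case/andP: uniq_xw.
have {}IHw := IHw (minn m x) x (geq_minr m x) min_w uniq_xw.
rewrite (_ : avoidw m l _ = [|| x < m, l < x | all (ltn^~ l) (x :: w)] &&
  avoidw (minn m x) x w) //; split.
  case/andP=> hd /IHw{}IHw [|b] [|c] //; last first.
    rewrite /= !ltnS => bc H1 H2; apply: (IHw b c) => //.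
    case: H1 => [ltm|[[|a] /= ltab lta]]; first by left; rewrite /=; lia.
      by left; rewrite /=; lia.
    by right; exists a.
  case: c => [|c] //=; rewrite !ltnS => ltc [ltmx|[]//] ltxl ltlc.
  case/or3P: hd => [||/allP/(_ (nth 0 w c))]; try lia.
  by rewrite inE mem_nth ?orbT // => /(_ isT) /=; lia.
move=> H; apply/andP; split; last first.
  apply/IHw => b c bc H1 H2; apply: (H b.+1 c.+1) => //.
  case: H1 => [|[a ltab lta]]; last by right; exists a.+1.
  rewrite /minn; case: ifP => _ ltz; first by left.
  (* The minimum is now [x], at index 1 of [l :: x :: w]. It cannot play both 1 and 3, so [b] is
     positive. *)
  case: b bc H2 ltz => [|b] bc H2 ltz; first by move: H2 ltz => /=; lia.
  by right; exists 1.
apply/negPn/negP; rewrite !negb_or -!leqNgt => /and3P[lemx lexl /allPn [y xwy]].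
rewrite -leqNgt => lely.
have neq_lx : l != x by apply: contraNneq lw => ->; rewrite mem_head.
have neq_ly : l != y by apply: contraNneq lw => ->.
have {xwy} wy : y \in w by move: xwy; rewrite inE; case: eqVneq => //; lia.
(* Here [l], [x], [y] play 3, 2, 4, and [m] plays 1. *)
apply: (H 0 (index y w).+2) => /=;
  by rewrite ?nth_index // ?ltnS ?index_mem //; lia.
Qed.

Lemma avoids_word n (s : 'S_n) : avoids_1_32_4 s = avoidw n n (word s).
Proof.
have uniq_w : uniq (word s) by rewrite (perm_uniq (word_perm s)) iota_uniq.
have w_lt x : x \in word s -> x < n.
  by rewrite (perm_mem (word_perm s)) mem_iota.
have nw : n \notin word s by apply/negP => /w_lt; rewrite ltnn.
have uniq_nw : uniq (n :: word s) by rewrite /= nw.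
have nth_lt i : i < n -> nth 0 (word s) i < n.
  by move=> lt_i; apply/w_lt/mem_nth; rewrite size_word.
apply/idP/idP.
  move=> av; apply/(avoidwP (leqnn n) nw uniq_nw) => b c.
  rewrite /= size_word ltnS => /andP[ltbc lecn].
  case: c ltbc lecn => // c; rewrite ltnS => ltbc ltcn.
  have ltbn := ltn_trans ltbc ltcn.
  (* The sentinel [n] exceeds every letter, so it cannot play 1, either as minimum or as entry 0 of
     [n :: word s]. *)
  case=> [|[[|a] ltab]]; try by move: (nth_lt b ltbn) => /=; lia.
  case: b ltbc ltbn ltab => // b ltbc ltbn; rewrite ltnS => ltab /= lta ltb ltc.
  have lta_n : a < n by lia.
  have ltb_n : b < n by lia.
  case/negP: av; apply/existsP; exists (Ordinal lta_n).
  apply/existsP; exists (Ordinal ltb_n); apply/existsP; exists (Ordinal ltbn).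
  apply/existsP; exists (Ordinal ltcn); rewrite /occurs_1_32_4 -!nth_word /=.
  by rewrite ltab eqxx ltbc lta ltb ltc.
move=> /(avoidwP (leqnn n) nw uniq_nw) H; apply/negP.
case/existsP=> a /existsP[b] /existsP[b'] /existsP[c].
case/and4P=> ltab /eqP eqb' ltbc; rewrite -!nth_word eqb'.
case/and3P=> lta ltb ltc.
apply: (H b.+1 c.+1) => //=.
  by rewrite -eqb' !ltnS ltbc size_word /=.
by right; exists a.+1.
Qed.

Lemma rlmaxwE m w : rlmaxw m w =
  \sum_(i < size w) (((m == 0) || (0 \in take i w)) &&
                     all (ltn^~ (nth 0 w i)) (drop i.+1 w)).
Proof.
elim: w m => [|x w IHw] m; first by rewrite big_ord0.
rewrite [LHS]/= big_ord_recl /= in_nil orbF drop0 IHw; congr (_ + _).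
apply: eq_bigr => i _; rewrite /= inE orbA [0 == x]eq_sym.
by congr (nat_of_bool ((_ || _) && _)); rewrite /minn; case: ltngtP; lia.
Qed.

Lemma nb_rl_max_word n (s : 'S_n) : nb_rl_max_right_of_1 s = rlmaxw n (word s).
Proof.
rewrite rlmaxwE size_word /nb_rl_max_right_of_1 cardsE -sum1_card big_mkcond.
apply: eq_bigr => i _.
rewrite -[LHS]/(nat_of_bool (rl_max s i && right_of_1 s i)) andbC.
have -> : (n == 0) = false by case: (n) i => // -[].
congr (nat_of_bool (_ && _)).
  apply/existsP/idP => [[p /andP[/eqP sp ltpi]]|/(nthP 0)[p]].
    apply/(nthP 0); exists p; first by rewrite size_take size_word ltn_ord.
    by rewrite nth_take // nth_word.
  rewrite size_take size_word ltn_ord => ltpi; rewrite nth_take // => sp.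
  exists (Ordinal (ltn_trans ltpi (ltn_ord i))).
  by rewrite -nth_word /= sp eqxx.
apply/forallP/(all_nthP 0) => H j.
  rewrite size_drop size_word nth_drop => ltj.
  have ltjn : i.+1 + j < n by lia.
  have := H (Ordinal ltjn); rewrite -!nth_word /= => /implyP; apply; lia.
apply/implyP => ltij; have ltjn := ltn_ord j.
have := H (j - i.+1); rewrite size_drop size_word nth_drop subnKC //.
by rewrite !nth_word; apply; lia.
Qed.

(** * The recurrence for [v] *)

(* The empty prefix is given the fictitious minimum and last letter [n]. *)
Lemma v_cnt (n k : nat) : v n k = cnt n n 0 0 k.
Proof.
rewrite /v.
under eq_finset do rewrite avoids_word nb_rl_max_word.
rewrite (card_perm_count n (fun w => avoidw n n w && (rlmaxw n w == k))).
rewrite -/(nb_words n n k (iota 0 n)) nb_wordsE ?iota_uniq ?size_iota //.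
- congr cnt.
  + rewrite -[RHS](size_iota 0 n); apply/eqP; rewrite -all_count.
    by apply/allP => x; rewrite mem_iota.
  + by apply/eqP; rewrite -leqn0 leqNgt -has_count; apply/hasPn => y _ /=; lia.
  + apply/eqP; rewrite -leqn0 leqNgt -has_count; apply/hasPn => x.
    by rewrite mem_iota /= => ltxn; rewrite -leqNgt ltnW.
- by rewrite mem_iota ltnn andbF.
- by rewrite mem_iota ltnn andbF.
- by rewrite mem_iota lt0n orbN.
Qed.

(** The position of the letter 1 is not to the right of itself, so it is never counted. *)
Lemma v_large (n : nat) : 0 < n -> v n n = 0.
Proof.
move=> n_gt0; apply/eqP; rewrite cards_eq0; apply/eqP/setP => s.
rewrite !inE; apply/negbTE; rewrite negb_and; apply/orP; right.
rewrite neq_ltn -{2}(card_ord n) -cardsT; apply/orP; left.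
apply/proper_card/properP; split; first exact: subsetT.
exists ((s^-1)%g (Ordinal n_gt0)); rewrite ?inE // negb_and; apply/orP; right.
apply/negP => /existsP[p /andP[/eqP sp]].
suff -> : p = (s^-1)%g (Ordinal n_gt0) by rewrite ltnn.
by apply: (@perm_inj _ s); rewrite permKV; apply: val_inj.
Qed.

Theorem corollary5p1 (n k : nat) (hk : (k < n)%N) :
  v n k%:Z = (v n.-1 (k%:Z - 1)%R + k.+1 * \sum_(k <= j < n.-1) v n.-1 j%:Z)%N.
Proof.
case: n hk => // n; rewrite ltnS succnK => lekn.
case: n lekn => [|n] lekn.
  have -> : k = 0 by lia.
  (* The value 1 on the right is the convention for [v 0 (-1)]. *)
  rewrite v_cnt big_geq // /cnt /= big_ord1 big_ord0; reflexivity.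
(* [n.+2] is the least cutoff that [cnt_grow] allows; the extra summand [v n.+1 n.+1] vanishes by
   [v_large]. *)
rewrite v_cnt (@cnt_grow n.+2) ?addn0 //.
have <- : grow n.+2 (fun j => v n.+1 j) k = grow n.+2 (cnt n.+1 n.+1 0 0) k.
  by apply: eq_grow => j; rewrite v_cnt.
rewrite /grow big_nat_recr // v_large //= addn0; congr (_ + _).
(* For [k = 0], the zero given by [shift] is the convention for [v n.+1 (-1)]. *)
case: k {lekn} => // k; rewrite /shift; transitivity (v n.+1 k) => //.
by congr (v _ _); lia.
Qed.
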